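(* The space $\mathbb{R}_0=(\mathbb{R},\tau_0)$ is $T_1$, compact, coherent, and well-filtered, but it has no bounded complete dcpo model.
   Context: $\tau_0$ is the topology on the set $\mathbb{R}$ of real numbers whose family of closed sets is $\mathcal{C}_0=\{\mathbb{R}\}\cup\{F\subseteq\mathbb{R}: F \text{ finite}\}\cup\{F\subseteq\mathbb{R}: 0\in F,\ |F|\le\aleph_0\}$ (this family is closed under arbitrary intersections and finite unions); $\mathbb{R}_0=(\mathbb{R},\tau_0)$ is called the anchored countable space. Compactness means every open cover has a finite subcover (no separation assumed). A subset of a space is saturated if it is an intersection of open sets. A space is coherent if the intersection of any two compact saturated subsets is compact. A space is well-filtered if for every filtered family $\{K_i\}_{i\in I}$ (nonempty, and any two members contain a common member) of compact saturated subsets and every open $U$ with $\bigcap_i K_i\subseteq U$, there is $i$ with $K_i\subseteq U$. A nonempty subset $D$ of a poset is directed if any two elements of $D$ have an upper bound in $D$. A dcpo is a poset in which every directed subset has a supremum. A poset is bounded complete if every nonempty upper-bounded subset has a supremum. The Scott topology $\Sigma(P)$ on a poset $P$ consists of the upper sets $U$ such that whenever $D\subseteq P$ is directed, $\bigvee D$ exists and $\bigvee D\in U$, then $D\cap U\ne\varnothing$. $\operatorname{Max}(P)$ is the set of maximal elements of $P$. A dcpo model of a space $X$ is a dcpo $P$ such that $\operatorname{Max}(P)$, with the subspace topology inherited from $\Sigma(P)$, is homeomorphic to $X$; it is a bounded complete dcpo model if $P$ is moreover bounded complete. *)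

(* Defs.v *)
From HB Require Import structures.
From mathcomp Require Import all_boot all_order all_algebra.
From mathcomp Require Import all_classical all_reals topology.

Set Implicit Arguments.
Unset Strict Implicit.
Unset Printing Implicit Defensive.

Import Order.TTheory GRing.Theory Num.Theory.

Local Open Scope classical_set_scope.
Local Open Scope ring_scope.

Section spaces.
Context (X : topologicalType).

Definition saturated (A : set X) :=
  exists2 F : set (set X), F `<=` open & A = \bigcap_(U in F) U.

(* Compactness is [cover_compact] throughout: the library's [compact] is the
   filter-theoretic notion, related to covers only on pointed spaces. *)
Definition compact_saturated (K : set X) := cover_compact K /\ saturated K.

Definition coherent := forall K L : set X,
  compact_saturated K -> compact_saturated L -> cover_compact (K `&` L).

Definition filtered_family (I : Type) (K : I -> set X) :=
  inhabited I /\ forall i j, exists k, K k `<=` K i `&` K j.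

Definition well_filtered := forall (I : Type) (K : I -> set X) (U : set X),
  filtered_family K -> (forall i, compact_saturated (K i)) -> open U ->
  \bigcap_i K i `<=` U -> exists i, K i `<=` U.

End spaces.

Arguments coherent : clear implicits.
Arguments well_filtered : clear implicits.

Definition homeomorphic (X Y : topologicalType) :=
  exists (f : X -> Y) (g : Y -> X),
    [/\ cancel f g, cancel g f, continuous f & continuous g].

Section posets.
Context (d : Order.disp_t) (P : porderType d).

Definition directed (D : set P) := D !=set0 /\
  forall x y, D x -> D y -> exists z, [/\ D z, (x <= z)%O & (y <= z)%O].

Definition dcpo := forall D : set P, directed D -> exists s, isLub D s.

Definition bounded_complete :=
  forall A : set P, A !=set0 -> has_ubound A -> exists s, isLub A s.

Definition upper_set (U : set P) := forall x y, U x -> (x <= y)%O -> U y.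

Definition scott_open (U : set P) := upper_set U /\
  forall (D : set P) s, directed D -> isLub D s -> U s -> D `&` U !=set0.

Definition maximal_elements : set P := [set x | forall y, (x <= y)%O -> y = x].

Definition scott_space : Type := P.

Lemma scott_openT : scott_open setT.
Proof. by split=> // D s [[x Dx] _] _ _; exists x. Qed.

Lemma scott_openI : setI_closed scott_open.
Proof.
move=> U V [upU sU] [upV sV]; split=> [x y [Ux Vx] xy|D s dD Ds [Us Vs]].
  by split; [exact: upU xy|exact: upV xy].
have [x [Dx Ux]] := sU D s dD Ds Us.
have [y [Dy Vy]] := sV D s dD Ds Vs.
have [z [Dz xz yz]] := dD.2 x y Dx Dy.
by exists z; split=> //; split; [exact: upU xz|exact: upV yz].
Qed.

Lemma scott_open_bigU (I : Type) (f : I -> set P) :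
  (forall i, scott_open (f i)) -> scott_open (\bigcup_i f i).
Proof.
move=> fo; split=> [x y [i _ fx] xy|D s dD Ds [i _ fs]].
  by exists i => //; exact: (fo i).1 xy.
have [x [Dx fx]] := (fo i).2 D s dD Ds fs.
by exists x; split=> //; exists i.
Qed.

HB.instance Definition _ := Choice.on scott_space.
HB.instance Definition _ := isOpenTopological.Build scott_space
  scott_openT scott_openI scott_open_bigU.

End posets.

Arguments dcpo {d} P.
Arguments bounded_complete {d} P.
Arguments maximal_elements {d} P.
Arguments scott_space {d} P.

(* Coercing a set to its subtype equips it with the subspace topology. *)
Definition max_space d (P : porderType d) : topologicalType :=
  set_type (maximal_elements P : set (scott_space P)).

Definition dcpo_model (X : topologicalType) d (P : porderType d) :=
  dcpo P /\ homeomorphic (max_space P) X.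

Definition bounded_complete_dcpo_model (X : topologicalType) d
    (P : porderType d) :=
  dcpo_model X P /\ bounded_complete P.

Section anchored_countable_space.
Context (R : realType).

Definition anchored_closed : set (set R) :=
  [set F | [\/ F = setT, finite_set F | F 0 /\ countable F]].

Definition anchored_countable : Type := R.

Let anchored_open : set (set R) := [set U | anchored_closed (~` U)].

Lemma anchored_openT : anchored_open setT.
Proof. by rewrite /anchored_open/= setCT; constructor 2. Qed.

Lemma anchored_openI : setI_closed anchored_open.
Proof.
have cntU (A B : set R) : countable A -> countable B -> countable (A `|` B).
  by move=> cA cB; rewrite -bigcup2E; apply: bigcup_countable => // -[|[|]].
have finC := @finite_set_countable R.
move=> U V; rewrite /anchored_open/= setCI.
case=> [->|fU|[U0 cU]]; first by rewrite setTU; constructor 1.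
- case=> [->|fV|[V0 cV]]; first by rewrite setUT; constructor 1.
    by constructor 2; rewrite finite_setU.
  by constructor 3; split; [right|apply: cntU => //; exact: finC].
- case=> [->|fV|[V0 cV]]; first by rewrite setUT; constructor 1.
    by constructor 3; split; [left|apply: cntU => //; exact: finC].
  by constructor 3; split; [left|exact: cntU].
Qed.

Lemma anchored_open_bigU (I : Type) (f : I -> set R) :
  (forall i, anchored_open (f i)) -> anchored_open (\bigcup_i f i).
Proof.
move=> fo; rewrite /anchored_open/= setC_bigcup.
have sub i : \bigcap_j ~` f j `<=` ~` f i by move=> x; exact.
have [[i fin]|nofin] := pselect (exists i, finite_set (~` f i)).
  by constructor 2; exact: sub_finite_set (sub i) fin.
have [[i [_ ci]]|nocount] :=
    pselect (exists i, (~` f i) 0 /\ countable (~` f i)).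
  constructor 3; split; last exact: sub_countable (subset_card_le (sub i)) ci.
  move=> j _; case: (fo j) => [->//|fj|[]//].
  by case: nofin; exists j.
constructor 1; apply/seteqP; split=> // x _ j _.
case: (fo j) => [->//|fj|cj]; first by case: nofin; exists j.
by case: nocount; exists j.
Qed.

HB.instance Definition _ := Choice.on anchored_countable.
HB.instance Definition _ := isOpenTopological.Build anchored_countable
  anchored_openT anchored_openI anchored_open_bigU.

Lemma closed_anchoredE :
  (closed : set (set anchored_countable)) = anchored_closed.
Proof.
by apply/funext => F; rewrite -[F]setCK closedC.
Qed.

End anchored_countable_space.

(* Main.v *)
(* In [R_0] the compact sets are those that are finite or contain [0], and a
   closed set missing [0], like a compact set missing [0], is finite; coherence
   and well-filteredness follow.

   Let [P] be a bounded complete dcpo model. For [x : P] put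
   [M x := Max P `&` {m | x <= m}]. Bounded completeness makes [M x] closed: it
   is the trace on [Max P] of the elements [y] having a common upper bound with
   [x], a Scott closed set, since a directed set of such [y] gives the directed
   set of joins [x \/ y]. Now fix a maximal point [m] other than the point [0].
   If [D] is directed with supremum [s] and [M s] is contained in [{m}], then
   some [M x], [x] in [D], misses [0]; being closed it is finite, so by
   filteredness some [M y], [y] in [D], is contained in [{m}]. Hence
   [{x | M x `<=` {m}}] is a Scott open set whose trace is [{m}], but [{m}] is
   not open in [R_0] because the real line is uncountable. *)
Require Import Defs.
From mathcomp Require Import all_boot all_order all_algebra.
From mathcomp Require Import finmap.
From mathcomp Require Import all_classical all_reals topology.
From mathcomp Require Import lebesgue_measure.

Set Implicit Arguments.
Unset Strict Implicit.
Unset Printing Implicit Defensive.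

Import Order.TTheory GRing.Theory Num.Theory.

Local Open Scope classical_set_scope.
Local Open Scope ring_scope.

Lemma finite_subset_cover_finite (I : choiceType) (D : set I) (U : Type)
    (f : I -> set U) (A : set U) :
  finite_set A -> A `<=` cover D f -> finite_subset_cover D f A.
Proof.
move=> finA AD; have [->|/set0P[x0 Ax0]] := eqVneq A set0.
  by exists fset0%fset.
(* A point of [A] supplies the index [i0], the default value of the choice function [g] outside
   [A]. *)
have [i0 _ _] := AD x0 Ax0.
have /choice[g gP] x : exists i, A x -> D i /\ f i x.
  have [/AD[i Di fx]|nAx] := pselect (A x); first by exists i.
  by exists i0.
have /finite_fsetP[G gAG] := finite_image g finA.
exists G => [i iG|x Ax].
  have : [set` G] i by [].
  by rewrite -gAG => -[x /gP[Dgx _] <-]; rewrite inE.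
exists (g x); last by have [] := gP x Ax.
by rewrite -gAG; exists x.
Qed.

Lemma infinite_countable_subset (T : Type) (A : set T) :
  infinite_set A -> exists B, [/\ B `<=` A, countable B & infinite_set B].
Proof.
move=> /infiniteP/card_subP[B + BA]; rewrite card_eq_le => /andP[cB infB].
by exists B; split=> //; exact/infiniteP.
Qed.

(** Each of the finitely many points of [K i] outside [U] is avoided by some member; filteredness
    merges these members and [K i] into one. [U] is arbitrary because it will also be a singleton
    that is not open. *)
Lemma filtered_family_finite (T : topologicalType) (I : Type)
    (K : I -> set T) (U : set T) (i : I) :
  filtered_family K -> finite_set (K i `\` U) -> \bigcap_j K j `<=` U ->
  exists j, K j `<=` U.
Proof.
move=> [_ Kf] /finite_seqP[s sE] KU.
have [j Kj] : exists j, forall x, x \in s -> ~ K j x.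
  have : forall x, x \in s -> ~ U x.
    by move=> x xs; have : [set` s] x by []; rewrite -sE => -[].
  elim: s {sE} => [|x s IHs] sU; first by exists i.
  have [j Kj] : exists j, forall y, y \in s -> ~ K j y.
    by apply: IHs => y ys; apply: sU; rewrite inE ys orbT.
  have [k Kk] : exists k, ~ K k x.
    apply: contrapT => nK; apply: (sU x (mem_head _ _)).
    by apply: KU => k _; apply: contrapT => Kkx; apply: nK; exists k.
  have [l lE] := Kf j k; exists l => y; rewrite inE => /orP[/eqP->|ys] /lE[]//.
  by move=> /(Kj y ys).
have [k kij] := Kf i j; exists k => x /kij[Kix Kjx].
apply: contrapT => Ux; apply: (Kj x) => //.
by have : (K i `\` U) x by []; rewrite sE.
Qed.

Lemma uncountable_realType (R : realType) : ~ countable [set: R].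
Proof.
move=> /countable_lebesgue_measure0.
by rewrite -set_itvNyy lebesgue_measure_itv.
Qed.

Section bounded_complete_scott.
Context (d : Order.disp_t) (P : porderType d).
Hypotheses (dcpoP : dcpo P) (bcP : bounded_complete P).

Lemma closed_common_upper (x : P) :
  closed ([set y | exists2 z, (x <= z)%O & (y <= z)%O] : set (scott_space P)).
Proof.
rewrite -openC; split=> [y z nxy yz [t xt zt]|D s dirD Ds ns].
  by apply: nxy; exists t => //; exact: le_trans yz zt.
apply: contrapT => DC; apply: ns.
have joinP y : D y -> exists e, isLub [set x; y] e.
  move=> Dy; have [z xz yz] : exists2 z, (x <= z)%O & (y <= z)%O.
    by apply: contrapT => nxy; apply: DC; exists y.
  apply: bcP; first by exists x; left.
  by exists z => _ [|]->.
(* The joins of [x] with elements of [D] are directed, since joining with [x] is monotone. Their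
   supremum [t] bounds [x] and all of [D], hence also [s]. *)
pose J := [set e | exists2 y, D y & isLub [set x; y] e].
have [t [tub tlub]] : exists t, isLub J t.
  apply: dcpoP; split.
    by have [y Dy] := dirD.1; have [e eP] := joinP y Dy; exists e, y.
  move=> e1 e2 [y1 Dy1 [_ l1]] [y2 Dy2 [_ l2]].
  have [y [Dy y1y y2y]] := dirD.2 _ _ Dy1 Dy2.
  have [e eP] := joinP y Dy; have [eub _] := eP.
  exists e; split; first by exists y.
  - by apply: l1 => _ [|]->; [|apply: le_trans y1y _]; apply: eub; [left|right].
  - by apply: l2 => _ [|]->; [|apply: le_trans y2y _]; apply: eub; [left|right].
have le_t y : D y -> (x <= t)%O /\ (y <= t)%O.
  move=> Dy; have [e eP] := joinP y Dy; have [eub _] := eP.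
  have et : (e <= t)%O by apply: tub; exists y.
  by split; apply: le_trans et; apply: eub; [left|right].
exists t; first by have [y Dy] := dirD.1; have [] := le_t y Dy.
by apply: Ds.2 => y /le_t[].
Qed.

Context (X : topologicalType) (h : X -> scott_space P).
Hypotheses (h_cts : continuous h) (h_max : forall r, maximal_elements P (h r)).

Lemma closed_upper_trace (x : P) : closed [set r | (x <= h r :> P)%O].
Proof.
have := (continuous_closedP h).1 h_cts _ (@closed_common_upper x).
congr closed; apply/seteqP; split=> [r [z xz hz]|r xr].
  (* A common upper bound of [x] and the maximal element [h r] is [h r] itself. *)
  by rewrite /= -(h_max hz).
by exists (h r).
Qed.

End bounded_complete_scott.

Section anchored_countable_theory.
Context (R : realType).
Notation X := (anchored_countable R).

Lemma open_anchoredE (U : set X) : open U = anchored_closed (~` U).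
Proof. by []. Qed.

Lemma accessible_anchored : accessible_space X.
Proof.
apply/accessible_finite_set_closed => A finA.
by rewrite closed_anchoredE; constructor 2.
Qed.

Lemma closed_anchored_finite (F : set X) :
  closed F -> ~ F (0 : R) -> finite_set F.
Proof. by rewrite closed_anchoredE => -[->/(_ I)| |[]]. Qed.

(** An open set around 0 is cofinite, so one member of a cover takes in all but finitely many points
    of a [K] containing 0. *)
Lemma cover_compact_anchoredP (K : set X) :
  cover_compact K <-> K (0 : R) \/ finite_set K.
Proof.
split=> [cK|[K0|finK]]; last first.
- by move=> I D f _; exact: finite_subset_cover_finite.
- move=> I D f fo KD; have [i Di fi0] := KD _ K0.
  have finC : finite_set (~` f i).
    by apply: closed_anchored_finite; [exact/open_closedC/fo|exact].
  have [|x [/KD]|] := @finite_subset_cover_finite _ D _ f (K `\` f i) => //.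
    by apply: sub_finite_set finC => x [].
  move=> E ED KE; exists (i |` E)%fset => [j|x Kx].
    by rewrite in_fset1U => /orP[/eqP->|/ED//]; rewrite inE.
  have [fx|nfx] := pselect (f i x); first by exists i; rewrite //= fset1U1.
  by have [j jE fjx] := KE x (conj Kx nfx); exists j; rewrite //= fset1Ur.
apply: contrapT => /not_orP[K0 /infinite_countable_subset[B [BK cB]]]; apply.
(* The only point of [B] that [f b] can contain is [b], so a finite subcover would have all of the
   infinite set [B] among its indices. *)
pose f (b : X) : set X := ~` ((0 : R) |` (B `\ b)).
have [||E _ KE] := cK X K f.
- move=> b _; rewrite open_anchoredE setCK; constructor 3; split; first by left.
  rewrite -bigcup2E; apply: bigcup_countable => // -[|[|]]//= _.
  exact: sub_countable (subset_card_le (@subDsetl _ _ _)) cB.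
- by move=> x Kx; exists x => // -[x0|[_ /(_ erefl)]]//; apply: K0; rewrite -x0.
apply: sub_finite_set (finite_fset E) => b Bb.
have [c cE fcb] := KE b (BK b Bb).
suff <- : c = b by [].
by apply: contrapT => cb; apply: fcb; right; split=> // bc; apply: cb.
Qed.

Lemma coherent_anchored : coherent X.
Proof.
move=> K L [/cover_compact_anchoredP cK _] [/cover_compact_anchoredP cL _].
apply/cover_compact_anchoredP; case: cK => [K0|finK]; last first.
  by right; apply: sub_finite_set finK => x [].
case: cL => [L0|finL]; first by left.
by right; apply: sub_finite_set finL => x [].
Qed.

Lemma well_filtered_anchored : well_filtered X.
Proof.
move=> I K U Kf cK oU KU.
suff [i] : exists i, finite_set (K i `\` U).
  by move/(filtered_family_finite Kf); apply.
(* If 0 is in [U], then [U] is cofinite and any member will do; otherwise some member misses 0 and,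
   being compact, is finite. *)
have [U0|nU0] := pselect (U (0 : R)).
  have [[i] _] := Kf; exists i.
  have finC : finite_set (~` U).
    by apply: closed_anchored_finite; [exact: open_closedC|exact].
  by apply: sub_finite_set finC => x [].
have [i nKi0] : exists i, ~ K i (0 : R).
  apply: contrapT => nK; apply: nU0; apply: KU => i _.
  by apply: contrapT => Ki0; apply: nK; exists i.
exists i; have [/cover_compact_anchoredP[//|finK] _] := cK i.
exact: finite_setD.
Qed.

Lemma open_anchored_set1 (r : X) : ~ open [set r].
Proof.
rewrite open_anchoredE.
have cnt : countable (~` [set r]) -> False.
  move=> cr; apply: (@uncountable_realType R).
  rewrite -(setvU [set r]) -bigcup2E.
  by apply: bigcup_countable => // -[|[|i]] _ //=; exact: countable1.
case=> [|/finite_set_countable/cnt|[_ /cnt]]//.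
by move=> /seteqP[_ /(_ r I)]; exact.
Qed.

Lemma no_bounded_complete_anchored (d : Order.disp_t) (P : porderType d)
    (h : X -> scott_space P) :
  dcpo P -> bounded_complete P -> injective h -> continuous h ->
  ~ forall r, maximal_elements P (h r).
Proof.
move=> dcpoP bcP h_inj h_cts h_max.
pose M (x : P) : set X := [set r | (x <= h r :> P)%O].
have M_closed x : closed (M x) by exact: closed_upper_trace.
apply: (@open_anchored_set1 (1 : R)).
have h_le r s : (h r <= h s :> P)%O -> s = r by move/h_max/h_inj.
(* The point 1 serves as the maximal point other than 0. By maximality and injectivity [M (h r)] is
   the singleton of [r]. *)
have -> : [set (1 : R)] = h @^-1` [set x | M x `<=` [set (1 : R)]].
  by apply/seteqP; split=> [_ -> s /h_le|s]//; apply; exact: lexx.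
apply: (iffLR (continuousP h)) => //; split=> [x y Mx xy r yr|D s dirD Ds Ms].
  by apply: Mx; exact: le_trans xy yr.
pose K (x : {x | D x}) := M (sval x).
have Kf : filtered_family K.
  split; first by have [x Dx] := dirD.1; exists; exists x.
  move=> [x Dx] [y Dy]; have [z [Dz xz yz]] := dirD.2 x y Dx Dy.
  exists (exist _ z Dz) => r zr.
  by split; [exact: le_trans xz zr|exact: le_trans yz zr].
(* A point whose image lies above every element of [D] lies in [M s]. *)
have KM : \bigcap_i K i `<=` [set (1 : R)].
  move=> r Kr; apply: Ms; apply: Ds.2 => x Dx.
  exact: (Kr (exist _ x Dx)).
have [[x Dx] Kx0] : exists i, ~ K i (0 : R).
  apply: contrapT => nK; have : [set (1 : R)] 0.
    by apply: KM => i _; apply: contrapT => Ki0; apply: nK; exists i.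
  by move/eqP; rewrite eq_sym oner_eq0.
have [|[y Dy] Ky] := @filtered_family_finite _ _ _ _ (exist _ x Dx) Kf _ KM.
  exact/finite_setD/(closed_anchored_finite (M_closed x)).
by exists y.
Qed.

End anchored_countable_theory.

Theorem theorem2p5 (R : realType) :
  [/\ accessible_space (anchored_countable R),
      cover_compact [set: anchored_countable R],
      coherent (anchored_countable R),
      well_filtered (anchored_countable R) &
      ~ exists (d : Order.disp_t) (P : porderType d),
          bounded_complete_dcpo_model (anchored_countable R) P].
Proof.
split.
- exact: accessible_anchored.
- by apply/cover_compact_anchoredP; left.
- exact: coherent_anchored.
- exact: well_filtered_anchored.
(* The embedding [h] is the homeomorphism [g] onto the maximal elements followed by their inclusion
   in [P]. *)
move=> [d [P [[dcpoP [f [g [_ gK _ g_cts]]]] bcP]]].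
apply: (@no_bounded_complete_anchored R d P (set_val \o g)) => //.
- exact: inj_comp val_inj (can_inj gK).
- move=> r; apply: continuous_comp; first exact: g_cts.
  exact: initial_continuous.
- by move=> r; exact: set_valP.
Qed.
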